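(* Let $(\mathcal{H}, * )$ be a semigroup. Then the following two statements are equivalent: (i) There are a nonempty set $X$ and a partition $P = \{X_j \colon j \in J\}$ of $X$ such that $(\mathcal{H}, * )$ is isomorphic to $\mathcal{B}_X(P\otimes P)$, where $P \otimes P = \{X_i \times X_j \colon i, j \in J\}$. (ii) $(\mathcal{H}, * ) \in \mathbf{H}_1$.
   Context: A partition of a nonempty set $X$ is a set of nonempty, pairwise disjoint subsets of $X$ whose union is $X$. $\mathcal{B}_X$ is the semigroup of all binary relations on $X$ (subsets of $X^2$) under composition: $\langle x,y\rangle\in\psi\circ\gamma$ iff there is $z\in X$ with $\langle x,z\rangle\in\psi$ and $\langle z,y\rangle\in\gamma$. For nonempty $A\subseteq\mathcal{B}_X$, $\mathcal{B}_X(A)$ is the subsemigroup of $\mathcal{B}_X$ generated by $A$ (all finite compositions of one or more elements of $A$). A semigroup is a nonempty set with an associative multiplication. If a semigroup $\mathcal{S}$ has one element, that element is regarded as its identity element. If $|\mathcal{S}|\geqslant 2$, a zero element of $\mathcal{S}$ is an element $\theta$ with $\theta*s=s*\theta=\theta$ for all $s\in\mathcal{S}$. An idempotent is an element $i$ with $i*i=i$; a nontrivial idempotent is an idempotent which is not the zero element (if a zero exists) and not the identity element (if an identity exists). $\mathbf{H}_1$ is the class of all semigroups $(\mathcal{H},* )$ such that either $|\mathcal{H}|=1$ or the following hold: (1) $\mathcal{H}$ contains a zero element $\theta$. (2) $x*y=\theta$ for all distinct idempotent elements $x,y\in\mathcal{H}$. (3) If $i_l$ and $i_r$ are nontrivial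 idempotent elements of $\mathcal{H}$, then there is a unique nonzero $a\in\mathcal{H}$ such that $a=i_l*a*i_r$. (4) For every nonzero $a\in\mathcal{H}$ there is a unique pair $(i_{la},i_{ra})$ of nontrivial idempotent elements of $\mathcal{H}$ such that $a=i_{la}*a*i_{ra}$. (5) For all nonzero $a,b\in\mathcal{H}$ and all pairs $(i_{la},i_{ra})$ and $(i_{lb},i_{rb})$ of nontrivial idempotent elements of $\mathcal{H}$ such that $a=i_{la}*a*i_{ra}$, $b=i_{lb}*b*i_{rb}$ and $i_{ra}=i_{lb}$, it holds that $a*b\neq\theta$. *)

(* Defs.v *)
From HB Require Import structures.
From mathcomp Require Import ssreflect ssrfun ssrbool eqtype choice ssrnat seq.
From mathcomp Require Import monoid.
From mathcomp Require Import boolp classical_sets.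

Set Implicit Arguments.
Unset Strict Implicit.
Unset Printing Implicit Defensive.

Local Open Scope classical_set_scope.
Local Open Scope group_scope.

(* A semigroupType may be empty, and it carries a choiceType structure, which
   boolp provides on every type: nonemptiness is stated separately, as
   inhabited H. *)

Section SemigroupElements.
Variable S : semigroupType.
Implicit Types (e i s t x y : S).

Definition is_zero t := (exists x y, x <> y) /\ forall s, t * s = t /\ s * t = t.

(* In a one-element semigroup the only element satisfies this. *)
Definition is_identity e := forall s, e * s = s /\ s * e = s.

Definition idempotent_elt i := i * i = i.

Definition nontrivial_idempotent i :=
  [/\ idempotent_elt i, ~ is_zero i & ~ is_identity i].

Definition subsemigroup (M : set S) := forall x y, M x -> M y -> M (x * y).

Definition generated (A : set S) : set S := smallest subsemigroup A.

Lemma generated_subsemigroup (A : set S) : subsemigroup (generated A).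
Proof. by move=> x y Ax Ay M HM; apply: HM.1; [apply: Ax | apply: Ay]. Qed.

(* The generated subsemigroup consists of the products of nonempty finite
   sequences of generators. *)
Lemma generatedP (A : set S) x :
  generated A x <->
  exists a (l : seq S),
    [/\ A a, {in l, forall b, A b} & x = foldl (fun u v => u * v) a l].
Proof.
split=> [gx|[a [l [Aa Al ->]]] M [HM AM]]; last first.
  have: M a by exact: AM.
  elim: l a {Aa} Al => //= b l IHl a Al Ma; apply: IHl.
    by move=> c cl; apply: Al; rewrite inE cl orbT.
  by apply: HM => //; apply: AM; apply: Al; rewrite inE eqxx.
move: x gx; apply: smallest_sub; last by move=> a Aa; exists a, [::].
have foldlM (u v : S) l :
    u * foldl (fun x y => x * y) v l = foldl (fun x y => x * y) (u * v) l.
  by elim: l v => //= b l IHl v; rewrite IHl mulgA.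
move=> _ _ [a [l [Aa Al ->]]] [b [r [Ab Ar ->]]].
exists a, (l ++ b :: r); split=> // [c|].
  by rewrite mem_cat inE => /or3P[/Al|/eqP->|/Ar].
by rewrite foldl_cat /= foldlM.
Qed.

Section GeneratedSemigroup.
Variable A : set S.

Record generated_semigroup := GeneratedElt {
  generated_val : S;
  generated_valP : generated_val \in generated A
}.

HB.instance Definition _ := [isSub for generated_val].
HB.instance Definition _ := [Choice of generated_semigroup by <:].

Lemma generated_mulg_closed : mulg_closed [in generated A].
Proof.
move=> x y; rewrite !unfold_in => /asboolP Ax /asboolP Ay.
by apply/asboolP; apply: generated_subsemigroup.
Qed.

HB.instance Definition _ :=
  SubChoice_isSubSemigroup.Build S _ generated_semigroup generated_mulg_closed.

End GeneratedSemigroup.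

End SemigroupElements.

Definition semigroup_isomorphic (G H : semigroupType) :=
  exists2 f : G -> H, {morph f : x y / x * y} & bijective f.

Definition binrel (X : Type) : Type := set (X * X).

Section BinaryRelations.
Variable X : Type.

HB.instance Definition _ := Choice.copy (binrel X) (set (X * X)).

(* In relation_scope, "\;" composes its right operand first. *)
Definition binrel_comp (psi gamma : binrel X) : binrel X :=
  (gamma \; psi)%relation.

Lemma binrel_compA : associative binrel_comp.
Proof.
move=> p q r; apply/seteqP; split=> -[x y] /=.
  by case=> u pu [v qv rv]; exists v => //; exists u.
by case=> v [u pu qv] rv; exists u => //; exists v.
Qed.

HB.instance Definition _ := isSemigroup.Build (binrel X) binrel_compA.

Definition tensor_square (P : set (set X)) : set (binrel X) :=
  [set (A `*` B : binrel X) | A in P & B in P].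

End BinaryRelations.

Definition in_H1 (H : semigroupType) :=
  (exists x : H, forall y, y = x) \/
  exists theta : H,
  [/\ is_zero theta,
      forall x y : H, idempotent_elt x -> idempotent_elt y -> x <> y ->
        x * y = theta,
      forall il ir : H, nontrivial_idempotent il -> nontrivial_idempotent ir ->
        exists! a : H, a <> theta /\ a = il * a * ir,
      forall a : H, a <> theta ->
        exists! p : H * H,
          [/\ nontrivial_idempotent p.1, nontrivial_idempotent p.2
            & a = p.1 * a * p.2]
    & forall a b : H, a <> theta -> b <> theta ->
        forall ila ira ilb irb : H,
        nontrivial_idempotent ila -> nontrivial_idempotent ira ->
        nontrivial_idempotent ilb -> nontrivial_idempotent irb ->
        a = ila * a * ira -> b = ilb * b * irb -> ira = ilb ->
        a * b <> theta].

(* Main.v *)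
(** If the partition has at least two blocks [X_j], then [B_X(P (x) P)] consists
    of the empty relation and the rectangles [X_i * X_j], which multiply like
    matrix units: [(X_i * X_j)(X_k * X_l)] is [X_i * X_l] if [j = k] and is empty
    otherwise. A semigroup of more than one element belongs to [H_1] exactly
    when it is such a semigroup of matrix units, indexed by its nontrivial
    idempotents, and this index set determines it up to isomorphism; so one may
    take for [X] the set of nontrivial idempotents, partitioned into
    singletons. *)

Require Import Defs.
From mathcomp Require Import ssreflect ssrfun ssrbool eqtype choice ssrnat seq.
From mathcomp Require Import monoid.
From mathcomp Require Import boolp classical_sets.

Set Implicit Arguments.
Unset Strict Implicit.
Unset Printing Implicit Defensive.

Local Open Scope classical_set_scope.
Local Open Scope group_scope.

Lemma sval_inj (T : Type) (P : T -> Prop) : injective (@sval T P).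
Proof. by move=> [x Px] [y Py] /= xy; apply: eq_exist. Qed.

(** This is the Brandt semigroup over the trivial group with index set [J]. That distinct pairs of
    indices give distinct units follows from the product rules, see [matrix_units_inj]. *)
Definition matrix_units (S : semigroupType) (J : Type) (theta : S)
    (e : J -> J -> S) :=
  [/\ forall s, theta * s = theta /\ s * theta = theta,
      forall i j, e i j <> theta,
      forall i j k, e i j * e j k = e i k,
      forall i j k l, j <> k -> e i j * e k l = theta
    & forall s, s = theta \/ exists i j, s = e i j].

(** * Calculus of matrix units *)

Section MatrixUnits.
Variables (S : semigroupType) (J : Type) (theta : S) (e : J -> J -> S).
Hypothesis mu : matrix_units theta e.

Let theta_mul s : theta * s = theta. Proof. by case: mu => /(_ s)[]. Qed.
Let mul_theta s : s * theta = theta. Proof. by case: mu => /(_ s)[]. Qed.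
Let e_neq0 i j : e i j <> theta. Proof. by case: mu. Qed.
Let e_mul i j k : e i j * e j k = e i k. Proof. by case: mu. Qed.
Let e_mul0 i j k l : j <> k -> e i j * e k l = theta.
Proof. by case: mu => _ _ _ + _; apply. Qed.
Let eP s : s = theta \/ exists i j, s = e i j. Proof. by case: mu. Qed.

Lemma matrix_units_mul_neq0 i j k l : e i j * e k l <> theta -> j = k.
Proof. by move=> e_neq; apply: contrapT => /e_mul0 /e_neq. Qed.

(** A diagonal unit detects an index: [e i i] on the left, or [e j j] on the right, fixes [e i j]
    but kills every unit with another index on that side. *)
Lemma matrix_units_inj i j k l : e i j = e k l -> i = k /\ j = l.
Proof.
move=> eq_e; split.
  apply: (@matrix_units_mul_neq0 i i k l).
  by rewrite -eq_e e_mul; apply: e_neq0.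
apply: esym; apply: (@matrix_units_mul_neq0 k l j j).
by rewrite -eq_e e_mul; apply: e_neq0.
Qed.

(** Source of both uniqueness claims in [in_H1]: the two diagonal units determine the unit between
    them, and conversely. *)
Lemma matrix_units_corner i j k l :
  e i j = e k k * e i j * e l l -> k = i /\ j = l.
Proof.
move=> eq_e; have: e k k * e i j * e l l <> theta by rewrite -eq_e.
have [<-|/e_mul0->] := pselect (k = i); last by rewrite theta_mul.
by rewrite e_mul => /matrix_units_mul_neq0.
Qed.

Section Idempotents.
Hypothesis J2 : exists i j : J, i <> j.

Lemma matrix_units_zero : is_zero theta.
Proof.
split; last by move=> s; split; [apply: theta_mul | apply: mul_theta].
by have [i _] := J2; exists (e i i), theta.
Qed.

Lemma matrix_units_idempotent s :
  idempotent_elt s -> s = theta \/ exists i, s = e i i.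
Proof.
move=> ss; have [->|[i [j s_e]]] := eP s; [by left | right; exists i].
have: e i j * e i j <> theta by rewrite -s_e ss s_e.
by move=> /matrix_units_mul_neq0 ji; rewrite s_e ji.
Qed.

Lemma matrix_units_nontrivial_idempotent s :
  nontrivial_idempotent s <-> exists i, s = e i i.
Proof.
split=> [[/matrix_units_idempotent[s0|//] s_neq0 _]|[i ->]].
  by case: s_neq0; rewrite s0; apply: matrix_units_zero.
split; first exact: e_mul.
  by move=> [_ /(_ theta)[]]; rewrite mul_theta => /esym /e_neq0.
(* Were [e i i] the identity, [e i i * e j j] would be the nonzero [e j j] for every [j], leaving
   [i] as the only index. *)
move=> e_id; have e_all j : i = j.
  by apply: (@matrix_units_mul_neq0 i i j j); rewrite (e_id _).1.
by have [j [k []]] := J2; rewrite -(e_all j) -(e_all k).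
Qed.

(** The nontrivial idempotents are exactly the diagonal units, so each condition reduces to a
    comparison of indices. *)
Lemma matrix_units_in_H1 : in_H1 S.
Proof.
right; exists theta; split=> [|x y xx yy|il ir|a a0|a b a0 b0 ila ira ilb irb].
- exact: matrix_units_zero.
- have [->|[i ->]] := matrix_units_idempotent xx; first by rewrite theta_mul.
  have [->|[j ->]] := matrix_units_idempotent yy; first by rewrite mul_theta.
  by move=> neq; apply: e_mul0 => ij; apply: neq; rewrite ij.
- move=> /matrix_units_nontrivial_idempotent[i ->].
  move=> /matrix_units_nontrivial_idempotent[j ->].
  exists (e i j); split; first by rewrite !e_mul.
  move=> b [b0]; have [//|[k [l ->]]] := eP b.
  by move=> /matrix_units_corner[-> ->].
- have [//|[i [j ->]]] := eP a.
  exists (e i i, e j j); split.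
    split; rewrite ?e_mul //=; apply/matrix_units_nontrivial_idempotent.
      by exists i.
    by exists j.
  move=> [p q] /= [/matrix_units_nontrivial_idempotent[k ->]].
  move=> /matrix_units_nontrivial_idempotent[l ->].
  by move=> /matrix_units_corner[-> ->].
- move=> /matrix_units_nontrivial_idempotent[p ->].
  move=> /matrix_units_nontrivial_idempotent[q ->].
  move=> /matrix_units_nontrivial_idempotent[r ->].
  move=> /matrix_units_nontrivial_idempotent[s ->].
  have [//|[i [j ->]]] := eP a; have [//|[k [l ->]]] := eP b.
  move=> /matrix_units_corner[_ <-] /matrix_units_corner[<- _].
  by move=> /matrix_units_inj[-> _]; rewrite e_mul.
Qed.

End Idempotents.

(** A nonzero element has only one pair of indices, so values may be prescribed freely on [theta]
    and on the units. *)
Lemma matrix_units_map (T : semigroupType) (theta' : T) (e' : J -> J -> T) :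
  exists f : S -> T, f theta = theta' /\ forall i j, f (e i j) = e' i j.
Proof.
have /choice[f fP] (s : S) : exists t,
    s = theta /\ t = theta' \/ exists i j, s = e i j /\ t = e' i j.
  have [->|[i [j ->]]] := eP s; first by exists theta'; left.
  by exists (e' i j); right; exists i, j.
exists f; split=> [|i j].
  by have [[]//|[i [j [/esym /e_neq0]]]] := fP theta.
by have [[/e_neq0]//|[k [l [/matrix_units_inj[-> ->]]]]//] := fP (e i j).
Qed.

Lemma matrix_units_bijective (T : semigroupType) (f : T -> S) :
  {morph f : x y / x * y} -> bijective f ->
  exists (theta' : T) (e' : J -> J -> T), matrix_units theta' e'.
Proof.
move=> fM [g fK gK]; have f_inj := can_inj fK.
exists (g theta), (fun i j => g (e i j)).
split=> [s|i j /(can_inj gK)/e_neq0//|i j k|i j k l jk|s].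
- by split; apply: f_inj; rewrite fM !gK.
- by apply: f_inj; rewrite fM !gK.
- by apply: f_inj; rewrite fM !gK e_mul0.
- have [fs|[i [j fs]]] := eP (f s); first by left; rewrite -fs fK.
  by right; exists i, j; rewrite -fs fK.
Qed.

End MatrixUnits.

(** The multiplication table depends on [J] alone, so the two maps that match units are morphisms
    inverse to each other. *)
Lemma matrix_units_isomorphic (J : Type) (S T : semigroupType)
    (theta : S) (e : J -> J -> S) (theta' : T) (e' : J -> J -> T) :
  matrix_units theta e -> matrix_units theta' e' -> semigroup_isomorphic S T.
Proof.
move=> mu mu'; have [f [f0 fe]] := matrix_units_map mu theta' e'.
have [g [g0 ge]] := matrix_units_map mu' theta e.
case: mu mu' => [z _ eM e0 eP] [z' _ eM' e0' eP'].
exists f => [x y|].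
  have [->|[i [j ->]]] := eP x; first by rewrite (z _).1 f0 (z' _).1.
  have [->|[k [l ->]]] := eP y; first by rewrite (z _).2 f0 (z' _).2.
  rewrite !fe; have [->|jk] := pselect (j = k); first by rewrite eM eM' fe.
  by rewrite e0 // e0'.
exists g => s.
  by have [->|[i [j ->]]] := eP s; rewrite ?f0 ?fe ?g0 ?ge.
by have [->|[i [j ->]]] := eP' s; rewrite ?g0 ?ge ?f0 ?fe.
Qed.

(** * From the axioms of [in_H1] to matrix units *)

Lemma in_H1_matrix_units (H : semigroupType) :
  in_H1 H -> (exists x : H, forall y, y = x) \/
  exists (theta : H)
    (e : {i : H | nontrivial_idempotent i} ->
         {i : H | nontrivial_idempotent i} -> H),
    matrix_units theta e /\
    exists i j : {i : H | nontrivial_idempotent i}, i <> j.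
Proof.
case=> [|[theta [zero idem0 cornerE cornerP mul_neq0]]]; [by left | right].
pose J := {i : H | nontrivial_idempotent i}.
have thetaP s : theta * s = theta /\ s * theta = theta.
  by case: zero => _ /(_ s).
have idem (i : J) : sval i * sval i = sval i by case: (svalP i).
have orth (i j : J) : i <> j -> sval i * sval j = theta.
  move=> ij; apply: idem0; [exact: idem | exact: idem |].
  by move=> /sval_inj.
(* The unit at [(i, j)] is the only nonzero element of the corner cut out by the idempotents [i] and
   [j]; [cornerP] will show that these units exhaust the nonzero elements. *)
have /choice[e eP] (p : J * J) := cornerE _ _ (svalP p.1) (svalP p.2).
have e_neq0 i j : e (i, j) <> theta by case: (eP (i, j)) => -[].
have eE i j : e (i, j) = sval i * e (i, j) * sval j.
  by case: (eP (i, j)) => -[].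
have e_uniq i j a : a <> theta -> a = sval i * a * sval j -> a = e (i, j).
  by move=> a0 aE; case: (eP (i, j)) => _ e_uniq; rewrite (e_uniq a).
have el i j : sval i * e (i, j) = e (i, j) by rewrite eE !mulgA idem.
have er i j : e (i, j) * sval j = e (i, j) by rewrite eE -!mulgA idem.
have eP' s : s = theta \/ exists i j, s = e (i, j).
  have [->|s0] := pselect (s = theta); [by left | right].
  have [[p q] [/= [pI qI sE] _]] := cornerP s s0.
  by exists (exist _ p pI), (exist _ q qI); apply: e_uniq.
exists theta, (fun i j => e (i, j)); split.
  split=> // [i j k|i j k l jk].
    (* The product lies in the corner of [i] and [k], and [mul_neq0] keeps it nonzero since the
       factors meet at [j]. *)
    apply: e_uniq; last by rewrite mulgA el -mulgA er.
    apply: (mul_neq0 _ _ _ _ (sval i) (sval j) (sval j) (sval k)) => //;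
      by [apply: svalP | apply: eE].
  (* Each factor absorbs its idempotent, so the zero product of [j] and [k] can be inserted in the
     middle. *)
  rewrite -er -[e (k, l)]el mulgA -[_ * sval j * _]mulgA orth //.
  by rewrite (thetaP _).2 (thetaP _).1.
(* [is_zero] provides two distinct elements; one of them is not [theta], hence is a unit and has
   indices. *)
have [i] : inhabited J.
  have [x [y xy]] := zero.1.
  have [xE|[i _]] := eP' x; last by constructor.
  have [yE|[i _]] := eP' y; last by constructor.
  by case: xy; rewrite xE yE.
(* If [i] were the only index, it would be the identity. *)
apply: contrapT => /forallNP all_eq.
have eq_i j : j = i.
  by apply: contrapT => ji; apply: (all_eq j); exists i.
have [_ _ []] := svalP i => s.
have [->|[j [k ->]]] := eP' s; first exact/and_comm/thetaP.
by rewrite (eq_i j) (eq_i k) el er.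
Qed.

(** * Rectangles of a partition as matrix units *)

Section Rectangles.
Variables (X J : Type) (F : J -> set X).
Variable P : set (set X).
Hypotheses (PE : P = range F) (F_triv : trivIset [set: J] F).
Hypothesis F_neq0 : forall j, F j !=set0.

Let rect i j : binrel X := F i `*` F j.

Let rect_mul i j k : rect i j * rect j k = rect i k.
Proof.
apply/seteqP; split=> -[x y] /=; first by case=> z [Fx _] [_ Fy].
by case=> Fx Fy; have [z Fz] := F_neq0 j; exists z.
Qed.

Let rect_mul0 i j k l : j <> k -> rect i j * rect k l = set0.
Proof.
move=> jk; apply/seteqP; split=> -[x y] //= [z [_ Fjz] [Fkz _]].
by apply: jk; apply: F_triv => //; exists z.
Qed.

Let set0_mul (s : binrel X) : (set0 : binrel X) * s = set0.
Proof. by apply/seteqP; split=> -[x y] //= [z]. Qed.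

Let mul_set0 (s : binrel X) : s * (set0 : binrel X) = set0.
Proof. by apply/seteqP; split=> -[x y] //= [z]. Qed.

Lemma generated_tensor_square_matrix_units : (exists i j : J, i <> j) ->
  exists (theta : generated_semigroup (tensor_square P))
    (e : J -> J -> generated_semigroup (tensor_square P)),
    matrix_units theta e.
Proof.
rewrite PE => -[i0 [j0 ij0]].
have rect_gen i j : generated (tensor_square (range F)) (rect i j).
  by move=> M [_]; apply; exists (F i); [exists i|exists (F j) => //; exists j].
(* The empty relation is generated as the product of the squares of two different blocks. *)
have gen0 : generated (tensor_square (range F)) set0.
  by rewrite -(rect_mul0 i0 j0 ij0); apply: generated_subsemigroup.
exists (GeneratedElt (mem_set gen0)).
exists (fun i j => GeneratedElt (mem_set (rect_gen i j))).
split=> [s|i j|i j k|i j k l jk|s].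
- by split; apply: val_inj; [apply: set0_mul | apply: mul_set0].
- move=> /(congr1 val) /= /seteqP[rect0 _].
  have [[x Fx] [y Fy]] := (F_neq0 i, F_neq0 j).
  exact: (rect0 (x, y)).
- exact/val_inj/rect_mul.
- exact/val_inj/rect_mul0.
suff: val s = set0 \/ exists i j, val s = rect i j.
  by move=> [s0|[i [j sE]]]; [left | right; exists i, j]; apply: val_inj.
(* The rectangles and the empty relation already form a subsemigroup containing the generators. *)
apply: (smallest_sub (X := [set x | x = set0 \/ exists i j, x = rect i j]))
  (set_mem (generated_valP s)).
  move=> x y [->|[i [j ->]]]; first by left; apply: set0_mul.
  move=> [->|[k [l ->]]]; first by left; apply: mul_set0.
  have [->|jk] := pselect (j = k); last by left; apply: rect_mul0.
  by right; exists i, l; apply: rect_mul.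
by move=> _ [_ [i _ <-]] [_ [j _ <-] <-]; right; exists i, j.
Qed.

(** The square of a single block is idempotent and generates only itself; the empty relation never
    arises, so this case is kept apart. *)
Lemma generated_tensor_square_trivial (i : J) : (forall j, j = i) ->
  exists x : generated_semigroup (tensor_square P), forall y, y = x.
Proof.
rewrite PE => all_i.
have gen_i : generated (tensor_square (range F)) (rect i i).
  by move=> M [_]; apply; exists (F i); [exists i|exists (F i) => //; exists i].
exists (GeneratedElt (mem_set gen_i)) => y; apply: val_inj => /=.
apply: (smallest_sub (X := [set rect i i])) (set_mem (generated_valP y)).
  by move=> p q -> ->; apply: rect_mul.
by move=> _ [_ [j _ <-]] [_ [k _ <-] <-]; rewrite (all_i j) (all_i k).
Qed.

End Rectangles.

Lemma partition_set1 (X : Type) :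
  partition (range (@set1 X)) id [set: X].
Proof.
split=> [|_ _ [x _ <-] [y _ <-] [z [/= -> ->]] //|_ [x _ <-]]; last by exists x.
by apply/seteqP; split=> // x _; exists [set x] => //; exists x.
Qed.

Lemma trivial_semigroup_isomorphic (S T : semigroupType) :
  (exists x : S, forall y, y = x) -> (exists x : T, forall y, y = x) ->
  semigroup_isomorphic S T.
Proof.
move=> [x xP] [y yP]; exists (fun=> y) => [? ?|]; first by rewrite [RHS]yP.
by exists (fun=> x) => ?; [rewrite [RHS]xP | rewrite [RHS]yP].
Qed.

Theorem theorem4p26 (H : semigroupType) (H_nonempty : inhabited H) :
  (exists (X : Type) (P : set (set X)),
     [/\ inhabited X,
         partition P id [set: X]
       & semigroup_isomorphic H (generated_semigroup (tensor_square P))])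
  <-> in_H1 H.
Proof.
split=> [[X [P [[x0] [P_cover P_triv P_neq0] [f fM f_bij]]]]|].
  (* The blocks index themselves, so distinct indices mean disjoint blocks. *)
  pose F (A : {A | P A}) := sval A.
  have F_triv : trivIset setT F.
    by move=> A B _ _ /(P_triv _ _ (svalP A) (svalP B)) /sval_inj.
  have F_neq0 A : F A !=set0 by apply: P_neq0; apply: svalP.
  have PE : P = range F.
    apply/seteqP; split=> [A PA|_ [A _ <-]]; first by exists (exist _ A PA).
    exact: svalP.
  have [J2|all_eq] := pselect (exists A B : {A | P A}, A <> B).
    have [theta [e mu]] :=
      generated_tensor_square_matrix_units PE F_triv F_neq0 J2.
    have [theta' [e' mu']] := matrix_units_bijective mu fM f_bij.
    exact: matrix_units_in_H1 mu' J2.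
  (* A point of [X] yields a block, which is then the only one. *)
  have [A PA _] : cover P id x0 by rewrite P_cover.
  have all_A B : B = exist _ A PA.
    by apply: contrapT => BA; apply: all_eq; exists B, (exist _ A PA).
  have [x xP] := generated_tensor_square_trivial PE F_neq0 all_A.
  have [y] := H_nonempty; left; exists y => z.
  by apply: (bij_inj f_bij); rewrite (xP (f z)) (xP (f y)).
move=> /in_H1_matrix_units[H1|[theta [e [mu J2]]]].
  exists unit, (range (@set1 unit)); split; first exact: (inhabits tt).
    exact: partition_set1.
  apply: trivial_semigroup_isomorphic => //.
  have set1_neq0 (i : unit) : [set i] !=set0 by exists i.
  apply: (@generated_tensor_square_trivial _ _ _ _ _ set1_neq0 tt) => //.
  by case.
have [i _] := J2.
(* With singleton blocks, the blocks are indexed by the same type as [e]. *)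
exists {i : H | nontrivial_idempotent i}, (range (@set1 _)); split.
- exact: (inhabits i).
- exact: partition_set1.
have set1_triv : trivIset setT (@set1 {i : H | nontrivial_idempotent i}).
  by move=> j k _ _ [x [-> ->]].
have set1_neq0 (j : {i : H | nontrivial_idempotent i}) : [set j] !=set0.
  by exists j.
have [theta' [e' mu']] :=
  generated_tensor_square_matrix_units (erefl _) set1_triv set1_neq0 J2.
exact: matrix_units_isomorphic mu mu'.
Qed.
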